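(* Let $(\mathbf{Q}_h^n,u_h^n,s^n)_{n\ge 0}$ be generated by the GSAV-EI scheme $$\mathcal{Q}(\tau\mathcal{L}_h)\,\frac{\mathbf{Q}_h^{n+1}-\mathbf{Q}_h^n}{\tau}+\mathcal{L}_h\mathbf{Q}_h^{n+1}=\mathbf{N}_h^n,\qquad \mathcal{Q}(\tau\mathcal{D}_h)\,\frac{u_h^{n+1}-u_h^n}{\tau}+\mathcal{D}_hu_h^{n+1}=\mathcal{N}_h^n,$$ $$s^{n+1}=s^n-\langle\mathbf{N}_h^n,\mathbf{Q}_h^{n+1}-\mathbf{Q}_h^n\rangle_h-\langle\mathcal{N}_h^n,u_h^{n+1}-u_h^n\rangle_h .$$ Put $\mathcal{E}_h^n=\mathcal{E}_h[\mathbf{Q}_h^n,u_h^n,s^n]$, where $$\mathcal{E}_h[\mathbf{Q}_h,u_h,s]=\frac K2\|\nabla_h\mathbf{Q}_h\|_h^2+B_0\|\Delta_hu_h\|_h^2+\frac\kappa2\big(\|\mathbf{Q}_h\|_h^2+\|u_h\|_h^2\big)+s .$$ Then for any $\kappa>0$ and any $\tau>0$, $$\mathcal{E}_h^{n+1}\le\mathcal{E}_h^n\qquad\text{for all } n\ge0 .$$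
   Context: **Model data.** $d\in\{2,3\}$, $\Omega=[0,L_d]^d$ with periodic boundary conditions. Parameters: $K>0$, $\alpha=a_1(\vartheta-\vartheta_1^* )$, $a=a_2(\vartheta-\vartheta_2^* )$ with $a_1,a_2>0$ and $\vartheta_2^*<\vartheta_1^*$, $\beta\ge0$, $\gamma>0$, $b\in\mathbb{R}$, $c>0$, $B_0>0$, $q=2\pi/l>0$, and a stabilization parameter $\kappa>0$. If ($d=3$ and $\alpha<\beta^2/(27\gamma)$) put $s_+=\frac{\beta+\sqrt{\beta^2-24\alpha\gamma}}{4\gamma}$; if ($d=2$ and $\alpha<0$) put $s_+=\sqrt{-2\alpha/\gamma}$; in the complementary case the model is the one obtained by setting $q=0$ in all formulas below (so no term containing $s_+$ is present). $\mathcal{S}^{(d)}$ is the space of real symmetric traceless $d\times d$ matrices, $\mathbf{I}_d$ the identity matrix, $A:B=\sum_{i,j}A_{ij}B_{ij}$, $|A|_F^2=A:A$. $\zeta\in C^1(\mathbb{R};(0,\infty))$ is a fixed function with $\zeta'\ge0$. Bulk potentials: $f_{\rm bn}(\mathbf{Q})=\frac\alpha2\operatorname{tr}(\mathbf{Q}^2)-\frac\beta3\operatorname{tr}(\mathbf{Q}^3)+\frac\gamma4(\operatorname{tr}(\mathbf{Q}^2))^2$, $f_{\rm bs}(u)=\frac a2u^2+\frac b3u^3+\frac c4u^4$. **Grid.** $h=L_d/J$, $J$ a positive integer; grid points $(p_1h,\dots,p_dh)$, $0\le p_i\le J$. $E_h^{\rm per}$ is the space of real grid functions that are $J$-periodic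 in every index. For $U\in E_h^{\rm per}$, $D_k^+U,D_k^-U$ are the forward and backward difference quotients in direction $k$, $D_k^c=\frac12(D_k^++D_k^-)$, $\nabla_hU=(D_1^+U,\dots,D_d^+U)$, $\Delta_hU=\sum_kD_k^+D_k^-U$, $\Delta_h^2=\Delta_h\Delta_h$, $D_h^2U=(D_i^cD_j^cU)_{i,j=1}^d$. $\langle U,V\rangle_h=h^d\sum_{p_1,\dots,p_d=1}^JU_pV_p$, $\|U\|_h^2=\langle U,U\rangle_h$, $\|\nabla_hU\|_h^2=\sum_k\|D_k^+U\|_h^2$. $\mathbb{M}_h^{(d)}$ is the space of $d\times d$ matrices with entries in $E_h^{\rm per}$, and $\mathcal{S}_h^{(d)}\subset\mathbb{M}_h^{(d)}$ the subspace of symmetric traceless ones; difference operators act entrywise, and inner products and squared norms are summed over entries. $\operatorname{div}_{h,c}^2\Phi=\sum_{i,j}D_i^cD_j^c\Phi^{ij}$ for $\Phi\in\mathbb{M}_h^{(d)}$. **Scheme data.** $\mathcal{L}_h=-K\Delta_h+\kappa$ on $\mathcal{S}_h^{(d)}$ and $\mathcal{D}_h=2B_0\Delta_h^2+\kappa$ on $E_h^{\rm per}$; $\mathcal{Q}(z)=z/(e^z-1)$ ($\mathcal{Q}(0)=1$), applied to self-adjoint operators by functional calculus. $\mathbf{M}_h^n=\mathbf{Q}_h^n/s_++\mathbf{I}_d/d$, and $$E_{1h}^n=E_{1h}[\mathbf{Q}_h^n,u_h^n]=2B_0q^2\langle D_h^2u_h^n,\mathbf{M}_h^nu_h^n\rangle_h+B_0q^4\|\mathbf{M}_h^nu_h^n\|_h^2+\langle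 f_{\rm bn}(\mathbf{Q}_h^n),1\rangle_h+\langle f_{\rm bs}(u_h^n),1\rangle_h-\tfrac\kappa2(\|u_h^n\|_h^2+\|\mathbf{Q}_h^n\|_h^2),$$ $g^n=\zeta(s^n)/\zeta(E_{1h}^n)$, $\mathbf{N}_h^n=-g^n\mathbf{H}_h^n$, $\mathcal{N}_h^n=-g^n\mu_h^n$, where $$\mathbf{H}_h^n=(\alpha-\kappa)\mathbf{Q}_h^n-\beta\Big((\mathbf{Q}_h^n)^2-\tfrac{\operatorname{tr}((\mathbf{Q}_h^n)^2)}d\mathbf{I}_d\Big)+\gamma\operatorname{tr}((\mathbf{Q}_h^n)^2)\mathbf{Q}_h^n+\tfrac{2B_0q^4}{s_+^2}\mathbf{Q}_h^n(u_h^n)^2+\tfrac{2B_0q^2}{s_+}\Big(u_h^nD_h^2u_h^n-\tfrac{\operatorname{tr}(u_h^nD_h^2u_h^n)}d\mathbf{I}_d\Big),$$ $$\mu_h^n=(a-\kappa)u_h^n+b(u_h^n)^2+c(u_h^n)^3+2B_0|q^2\mathbf{M}_h^n|_F^2u_h^n+2B_0q^2\big(\mathbf{M}_h^n:D_h^2u_h^n+\operatorname{div}_{h,c}^2(\mathbf{M}_h^nu_h^n)\big).$$ The time step is $\tau>0$. Initialization: $\mathbf{Q}_h^0\in\mathcal{S}_h^{(d)}$ and $u_h^0\in E_h^{\rm per}$ are the restrictions to the grid of given periodic initial data $\mathbf{Q}(0):\Omega\to\mathcal{S}^{(d)}$ and $u(0):\Omega\to\mathbb{R}$, and $s^0=E_{1h}[\mathbf{Q}_h^0,u_h^0]$.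 The scheme is equivalent to $\mathbf{Q}_h^{n+1}=e^{-\tau\mathcal{L}_h}\mathbf{Q}_h^n+\tau\varphi(\tau\mathcal{L}_h)\mathbf{N}_h^n$, $u_h^{n+1}=e^{-\tau\mathcal{D}_h}u_h^n+\tau\varphi(\tau\mathcal{D}_h)\mathcal{N}_h^n$ with $\varphi(z)=(1-e^{-z})/z$, together with the same update for $s$. *)

(* Defs.v *)
From HB Require Import structures.
From mathcomp Require Import all_boot all_order all_algebra.
From mathcomp Require Import all_classical all_reals all_analysis.
Set Implicit Arguments.
Unset Strict Implicit.
Unset Printing Implicit Defensive.
Import Order.TTheory GRing.Theory Num.Theory.
Import numFieldNormedType.Exports.
Local Open Scope ring_scope.

(* kappa, tau, the mesh and the function zeta are kept apart from this record. *)
Record model (R : Type) := Model {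
  pK : R;
  pa1 : R; pa2 : R; ptheta : R; ptheta1 : R; ptheta2 : R;
  pbeta : R; pgamma : R;
  pb : R; pc : R;
  pB0 : R; pl : R }.

Record admissible (R : realType) (m : model R) : Prop := Admissible {
  admK : 0 < pK m;
  adma1 : 0 < pa1 m;
  adma2 : 0 < pa2 m;
  admtheta : ptheta2 m < ptheta1 m;
  admbeta : 0 <= pbeta m;
  admgamma : 0 < pgamma m;
  admc : 0 < pc m;
  admB0 : 0 < pB0 m;
  adml : 0 < pl m }.

Definition alpha (R : realType) (m : model R) : R :=
  pa1 m * (ptheta m - ptheta1 m).

Definition acoef (R : realType) (m : model R) : R :=
  pa2 m * (ptheta m - ptheta2 m).

Definition ordered (R : realType) (d : nat) (m : model R) : bool :=
  ((d == 3)%N && (alpha m < pbeta m ^+ 2 / (27 * pgamma m))) ||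
  ((d == 2)%N && (alpha m < 0)).

Definition splus (R : realType) (d : nat) (m : model R) : R :=
  if (d == 3)%N then
    (pbeta m + Num.sqrt (pbeta m ^+ 2 - 24 * alpha m * pgamma m))
      / (4 * pgamma m)
  else Num.sqrt (- 2 * alpha m / pgamma m).

(* When [ordered d m] fails, [splus d m] is a junk value, but every occurrence
   of it below is in a product with a positive power of this wave number,
   which is then 0. *)
Definition wavenum (R : realType) (d : nat) (m : model R) : R :=
  if ordered d m then 2 * pi / pl m else 0.

Definition symtl_space (R : realType) (d : nat) : {vspace 'M[R]_d} :=
  (lker (linfun (fun A : 'M[R]_d => A - A^T)%R) :&:
   lker (linfun (fun A : 'M[R]_d => (\tr A)%R : R^o)))%VS.

Definition symtl (R : realType) (d : nat) := subvs_of (symtl_space R d).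

Lemma mem_symtl_space (R : realType) (d : nat) (A : 'M[R]_d) :
  (A \in symtl_space R d) = (A^T == A) && (\tr A == 0).
Proof.
pose s (B : 'M[R]_d) := B - B^T.
have sl : linear s.
  by move=> k B C; rewrite /s linearP /= scalerBr opprD addrACA.
pose t (B : 'M[R]_d) : R^o := \tr B.
have tl : linear t by move=> k B C; rewrite /t linearP.
pose sL := HB.pack_for {linear 'M[R]_d -> 'M[R]_d} s
  (GRing.isLinear.Build _ _ _ _ _ sl).
pose tL := HB.pack_for {linear 'M[R]_d -> R^o} t
  (GRing.isLinear.Build _ _ _ _ _ tl).
rewrite memv_cap !memv_ker.
have -> : linfun (fun B : 'M[R]_d => B - B^T) A = A - A^T by exact: (lfunE sL).
have -> : linfun (fun B : 'M[R]_d => \tr B : R^o) A = \tr A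
  by exact: (lfunE tL).
by rewrite subr_eq0 [A == _]eq_sym.
Qed.

(* A function that is J-periodic in every index is given by its values on
   one period: the indices are in (Z/JZ)^d, with representatives 0, ..., J-1.
   In particular the index J of the grid is the index 0. *)
Definition gidx (d J : nat) := {ffun 'I_d -> 'I_J}.
Definition grid (d J : nat) (V : Type) := {ffun gidx d J -> V}.

Section Operators.
Context {R : realType} {d J : nat}.
Variable h : R.

Definition gpoint (p : gidx d J) : 'rV[R]_d := \row_k ((p k)%:R * h).

Definition shiftp (k : 'I_d) (p : gidx d J) : gidx d J :=
  [ffun i => if i == k then ordS (p i) else p i].
Definition shiftm (k : 'I_d) (p : gidx d J) : gidx d J :=
  [ffun i => if i == k then ord_pred (p i) else p i].

(* The operations of a space of matrices are entrywise, hence so are these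
   difference operators when V is such a space. *)
Definition Dp (V : lmodType R) (k : 'I_d) (U : grid d J V) : grid d J V :=
  [ffun p => h^-1 *: (U (shiftp k p) - U p)].
Definition Dm (V : lmodType R) (k : 'I_d) (U : grid d J V) : grid d J V :=
  [ffun p => h^-1 *: (U p - U (shiftm k p))].
Definition Dc (V : lmodType R) (k : 'I_d) (U : grid d J V) : grid d J V :=
  2^-1 *: (Dp k U + Dm k U).
Definition lap (V : lmodType R) (U : grid d J V) : grid d J V :=
  \sum_(k < d) Dp k (Dm k U).

Definition hess (U : grid d J R^o) : grid d J 'M[R]_d :=
  [ffun p => \matrix_(i, j) Dc i (Dc j U) p].

Definition entry (Phi : grid d J 'M[R]_d) (i j : 'I_d) : grid d J R^o :=
  [ffun p => Phi p i j].

Definition div2c (Phi : grid d J 'M[R]_d) : grid d J R^o :=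
  \sum_(i < d) \sum_(j < d) Dc i (Dc j (entry Phi i j)).

Definition ip (U V : grid d J R^o) : R := h ^+ d * \sum_p (U p * V p).
Definition ipm (Phi Psi : grid d J 'M[R]_d) : R :=
  \sum_(i < d) \sum_(j < d) ip (entry Phi i j) (entry Psi i j).

Definition grad2 (U : grid d J R^o) : R := \sum_(k < d) ip (Dp k U) (Dp k U).
Definition grad2m (Phi : grid d J 'M[R]_d) : R :=
  \sum_(i < d) \sum_(j < d) grad2 (entry Phi i j).

Definition mxgrid (Q : grid d J (symtl R d)) : grid d J 'M[R]_d :=
  [ffun p => vsval (Q p)].

End Operators.

Definition frob (R : realType) (d : nat) (A B : 'M[R]_d) : R :=
  \sum_(i < d) \sum_(j < d) A i j * B i j.

(* Functional calculus: f(A) is the linear operator that acts as f lam on the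
   eigenspace of A for lam, for every lam.  Such an operator exists, since
   eigenspaces for distinct eigenvalues are independent, and it is unique when
   the eigenvectors of A span V, in particular when A is self-adjoint for
   some inner product on V. *)
Definition funcalc (R : realType) (V : vectType R) (f : R -> R) (A : V -> V) :
    'End(V) :=
  xget 0 [set B : 'End(V) | forall (lam : R) (v : V),
                              A v = lam *: v -> B v = f lam *: v]%classic.

Definition calQ (R : realType) (z : R) : R :=
  if z == 0 then 1 else z / (expR z - 1).

Section Scheme.
Context {R : realType} {d J : nat}.
Variables (m : model R) (kappa h : R).

Local Notation q := (wavenum d m).
Local Notation sp := (splus d m).
Local Notation B0 := (pB0 m).
Local Notation beta := (pbeta m).
Local Notation gamma := (pgamma m).

Definition opL (Q : grid d J (symtl R d)) : grid d J (symtl R d) :=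
  - (pK m *: lap h Q) + kappa *: Q.
Definition opD (u : grid d J R^o) : grid d J R^o :=
  (2 * B0) *: lap h (lap h u) + kappa *: u.

Definition fbn (A : 'M[R]_d) : R :=
  alpha m / 2 * \tr (A *m A) - beta / 3 * \tr (A *m A *m A)
  + gamma / 4 * (\tr (A *m A)) ^+ 2.
Definition fbs (x : R) : R :=
  acoef m / 2 * x ^+ 2 + pb m / 3 * x ^+ 3 + pc m / 4 * x ^+ 4.

Definition Mtens (Q : grid d J 'M[R]_d) : grid d J 'M[R]_d :=
  [ffun p => sp^-1 *: Q p + (d%:R^-1)%:M].

Definition scal (u : grid d J R^o) (Phi : grid d J 'M[R]_d) :
    grid d J 'M[R]_d :=
  [ffun p => (u p : R) *: Phi p].

Definition E1h (Q : grid d J 'M[R]_d) (u : grid d J R^o) : R :=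
  2 * B0 * q ^+ 2 * ipm h (hess h u) (scal u (Mtens Q))
  + B0 * q ^+ 4 * ipm h (scal u (Mtens Q)) (scal u (Mtens Q))
  + ip h [ffun p => fbn (Q p)] [ffun=> 1]
  + ip h [ffun p => fbs (u p)] [ffun=> 1]
  - kappa / 2 * (ip h u u + ipm h Q Q).

Definition tracefree (A : 'M[R]_d) : 'M[R]_d := A - (\tr A / d%:R)%:M.

Definition Hfield (Q : grid d J 'M[R]_d) (u : grid d J R^o) :
    grid d J 'M[R]_d :=
  [ffun p =>
     (alpha m - kappa) *: Q p
     - beta *: tracefree (Q p *m Q p)
     + (gamma * \tr (Q p *m Q p)) *: Q p
     + (2 * B0 * q ^+ 4 / sp ^+ 2 * (u p : R) ^+ 2) *: Q p
     + (2 * B0 * q ^+ 2 / sp) *: tracefree ((u p : R) *: hess h u p)].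

Definition mufield (Q : grid d J 'M[R]_d) (u : grid d J R^o) : grid d J R^o :=
  [ffun p =>
     (acoef m - kappa) * u p + pb m * u p ^+ 2 + pc m * u p ^+ 3
     + 2 * B0 * frob (q ^+ 2 *: Mtens Q p) (q ^+ 2 *: Mtens Q p) * u p
     + 2 * B0 * q ^+ 2 *
       (frob (Mtens Q p) (hess h u p) + div2c h (scal u (Mtens Q)) p)].

Definition gfac (zeta : R -> R) (Q : grid d J 'M[R]_d) (u : grid d J R^o)
    (s : R) : R :=
  zeta s / zeta (E1h Q u).

Definition Nfield (zeta : R -> R) (Q : grid d J 'M[R]_d) (u : grid d J R^o)
    (s : R) : grid d J 'M[R]_d :=
  [ffun p => - gfac zeta Q u s *: Hfield Q u p].
Definition calNfield (zeta : R -> R) (Q : grid d J 'M[R]_d)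
    (u : grid d J R^o) (s : R) : grid d J R^o :=
  - gfac zeta Q u s *: mufield Q u.

Definition energy (Q : grid d J (symtl R d)) (u : grid d J R^o) (s : R) : R :=
  pK m / 2 * grad2m h (mxgrid Q) + B0 * ip h (lap h u) (lap h u)
  + kappa / 2 * (ipm h (mxgrid Q) (mxgrid Q) + ip h u u) + s.

Definition gsav_ei_init (Qini : 'rV[R]_d -> symtl R d) (uini : 'rV[R]_d -> R)
    (Q0 : grid d J (symtl R d)) (u0 : grid d J R^o) (s0 : R) : Prop :=
  [/\ Q0 = [ffun p => Qini (gpoint h p)],
      u0 = [ffun p => uini (gpoint h p)] &
      s0 = E1h (mxgrid Q0) u0].

Definition gsav_ei_step (zeta : R -> R) (tau : R)
    (Q : grid d J (symtl R d)) (u : grid d J R^o) (s : R)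
    (Q' : grid d J (symtl R d)) (u' : grid d J R^o) (s' : R) : Prop :=
  let N := Nfield zeta (mxgrid Q) u s in
  let calN := calNfield zeta (mxgrid Q) u s in
  [/\ mxgrid (funcalc (@calQ R) (fun v => tau *: opL v) (tau^-1 *: (Q' - Q))
              + opL Q') = N,
      funcalc (@calQ R) (fun v => tau *: opD v) (tau^-1 *: (u' - u))
        + opD u' = calN &
      s' = s - ipm h N (mxgrid (Q' - Q)) - ip h calN (u' - u)].

End Scheme.

Definition box_periodic (R : realType) (d : nat) (T : Type) (L : R)
    (f : 'rV[R]_d -> T) : Prop :=
  forall (x : 'rV[R]_d) (k : 'I_d), f (x + L *: delta_mx 0 k) = f x.

(* Main.v *)
(* Write e = Q' - Q and x = u' - u.  For a self-adjoint operator A, the change of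
   the quadratic energy <A v, v>/2 over a step v -> v' is
   <A v', v' - v> - <A (v' - v), v' - v>/2.  Testing the scheme with e and x
   and inserting the update of s, the terms <A v', v' - v> cancel, and the
   energy changes by
     - <calQ(tau L) e, e>/tau - <L e, e>/2 - <calQ(tau D) x, x>/tau - <D x, x>/2,
   which is nonpositive because L, D >= 0 and z/(e^z - 1) >= 0 for all z.
   The functional calculus is handled through a real eigenbasis of the scalar
   discrete Laplacian, which by linearity also diagonalizes the Laplacian on
   grid functions with values in any vector space. *)
Require Import Defs.
From HB Require Import structures.
From mathcomp Require Import all_boot all_order all_algebra.
From mathcomp Require Import all_classical all_reals all_analysis.
From mathcomp Require Import ring lra complex spectral.
Set Implicit Arguments.
Unset Strict Implicit.
Unset Printing Implicit Defensive.
Import Order.TTheory GRing.Theory Num.Theory.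
Import numFieldNormedType.Exports.
Local Open Scope ring_scope.

(* A is unitarily diagonalizable over R[i] with real eigenvalues, and two real
   matrices that are similar over R[i] are similar over R. *)
Lemma realsym_diagonalizable (R : rcfType) n (A : 'M[R]_n) :
  A^T = A -> exists P : 'M[R]_n, exists D : 'rV[R]_n,
    P \in unitmx /\ P *m A = diag_mx D *m P.
Proof.
move=> symA; pose toC := real_complex R.
have toC_real x : toC x \is Num.real by rewrite complex_real.
have realE m p (B : 'M[R[i]]_(m, p)) : B \is a mxOver Num.real ->
    B = map_mx toC (map_mx (@complex.Re R) B).
  move=> /mxOverP Breal; apply/matrixP => i j; rewrite !mxE.
  by rewrite /toC RRe_real.
have realA : map_mx toC A \is a mxOver Num.real.
  by apply/mxOverP => i j; rewrite mxE.
have hermA : map_mx toC A \is hermsymmx.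
  apply: realsym_hermsym => //; apply/is_hermitianmxP.
  by rewrite expr0 scale1r map_mx_id// map_trmx symA.
have realD := hermitian_spectral_diag_real hermA.
have /orthomx_spectralP AE := hermitian_normalmx hermA.
set P := spectralmx _ in AE; set D := spectral_diag _ in AE realD.
have Punit : P \in unitmx by exact: spectral_unit.
have simAD : exists2 P, P \in unitmx & similar P (map_mx toC A) (diag_mx D).
  exists P => //; apply/similarP => //.
  by rewrite [X in P *m X]AE !mulmxA mulmxV// mul1mx.
have realdD : diag_mx D \is a mxOver Num.real.
  by apply/mxOverP => i j; rewrite mxE rpredMn// (mxOverP realD).
have [B] := real_similar simAD realA realdD.
rewrite !inE => /andP[/realE BE Bunit] /(similarP Bunit).
(* [B] and [D] are images of real matrices, so injectivity of [map_mx] brings the identity back to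
   [R]. *)
rewrite (realE _ _ D realD) -map_diag_mx {1 2}BE -!map_mxM => /map_mx_inj BA.
exists (map_mx (@complex.Re R) B), (map_mx (@complex.Re R) D); split=> //.
by rewrite BE map_unitmx in Bunit.
Qed.

(** * Semidefinite forms, functional calculus, and dissipation in one exponential step *)

Definition psd_form (R : realType) (V : lmodType R) (phi : V -> V -> R) : Prop :=
  [/\ forall w, linear (phi^~ w : V -> R^o),
      forall v w, phi v w = phi w v & forall v, 0 <= phi v v].

(** The [w k] may vanish or share an eigenvalue. As no basis is fixed, the property passes to
    polynomials in [A] with the same vectors. *)
Definition eigen_spanned (R : realType) (V : lmodType R) (A : V -> V) : Prop :=
  forall v, exists (n : nat) (lam : 'I_n -> R) (w : 'I_n -> V),
    v = \sum_k w k /\ forall k, A (w k) = lam k *: w k.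

Section Form.
Context {R : realType} {V : lmodType R} {phi : V -> V -> R}.
Hypothesis phiP : psd_form phi.

Lemma psd_formC v w : phi v w = phi w v. Proof. by case: phiP. Qed.

Lemma psd_form_ge0 v : 0 <= phi v v. Proof. by case: phiP. Qed.

Lemma psd_formDl v1 v2 w : phi (v1 + v2) w = phi v1 w + phi v2 w.
Proof.
by case: phiP => /(_ w 1 v1 v2) /=; rewrite !scale1r.
Qed.

Lemma psd_form0l w : phi 0 w = 0.
Proof. by apply: (addrI (phi 0 w)); rewrite -psd_formDl !addr0. Qed.

Lemma psd_formZl a v w : phi (a *: v) w = a * phi v w.
Proof.
by case: phiP => /(_ w a v 0) /=; rewrite addr0 psd_form0l addr0.
Qed.

Lemma psd_formDr v w1 w2 : phi v (w1 + w2) = phi v w1 + phi v w2.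
Proof. by rewrite ![phi v _]psd_formC psd_formDl. Qed.

Lemma psd_formZr a v w : phi v (a *: w) = a * phi v w.
Proof. by rewrite ![phi v _]psd_formC psd_formZl. Qed.

Lemma psd_formNl v w : phi (- v) w = - phi v w.
Proof. by rewrite -scaleN1r psd_formZl mulN1r. Qed.

Lemma psd_formNr v w : phi v (- w) = - phi v w.
Proof. by rewrite ![phi v _]psd_formC psd_formNl. Qed.

Lemma psd_formBl v1 v2 w : phi (v1 - v2) w = phi v1 w - phi v2 w.
Proof. by rewrite psd_formDl psd_formNl. Qed.

Lemma psd_formBr v w1 w2 : phi v (w1 - w2) = phi v w1 - phi v w2.
Proof. by rewrite ![phi v _]psd_formC psd_formBl. Qed.

Lemma psd_form_suml n (v : 'I_n -> V) w :
  phi (\sum_k v k) w = \sum_k phi (v k) w.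
Proof.
by elim/big_ind2: _ => [|v1 a v2 b <- <-|//]; rewrite ?psd_form0l ?psd_formDl.
Qed.

Lemma psd_form_sumr n v (w : 'I_n -> V) :
  phi v (\sum_k w k) = \sum_k phi v (w k).
Proof.
by rewrite psd_formC psd_form_suml; apply: eq_bigr => k _; rewrite psd_formC.
Qed.

(** Moving [A] across the form shows that [a] and [b] times [phi v w] agree. *)
Lemma eigenvectors_orthogonal (A : V -> V) (a b : R) v w :
  (forall v w, phi (A v) w = phi v (A w)) ->
  A v = a *: v -> A w = b *: w -> a != b -> phi v w = 0.
Proof.
move=> Asym Av Aw ab; have := Asym v w; rewrite Av Aw psd_formZl psd_formZr => /eqP.
by rewrite -subr_eq0 -mulrBl mulf_eq0 subr_eq0 (negPf ab) => /eqP.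
Qed.

End Form.

(* On v = sum_k w_k, with w_k an eigenvector for lam_k, the form is
   phi (f(A) v) v = phi z z for z = sum_k sqrt (f lam_k) w_k.  The second case
   of xgetP is the junk value 0 of funcalc. *)
Lemma funcalc_form_ge0 (R : realType) (V : vectType R) (phi : V -> V -> R)
    (A : V -> V) (f : R -> R) (v : V) :
  psd_form phi -> (forall v w, phi (A v) w = phi v (A w)) ->
  eigen_spanned A -> (forall x, 0 <= f x) -> 0 <= phi (funcalc f A v) v.
Proof.
move=> phiP Asym Aspan f0.
rewrite /funcalc; case: xgetP => [B _ /= BE|_]; last first.
  by rewrite lfunE /= (psd_form0l phiP).
have [n [lam [w [-> Aw]]]] := Aspan v.
pose z := \sum_k Num.sqrt (f (lam k)) *: w k.
suff -> : phi (B (\sum_k w k)) (\sum_k w k) = phi z z.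
  exact: (psd_form_ge0 phiP).
rewrite linear_sum /= !(psd_form_suml phiP); apply: eq_bigr => j _.
rewrite !(psd_form_sumr phiP); apply: eq_bigr => k _.
rewrite (BE _ _ (Aw j)) !(psd_formZl phiP) (psd_formZr phiP).
(* Equal eigenvalues have equal roots, with product [f (lam j)]; the pairing of [w j] and [w k] may
   be nonzero there. *)
have [<-|lam_neq] := eqVneq (lam j) (lam k).
  by rewrite mulrA -expr2 sqr_sqrtr.
by rewrite (eigenvectors_orthogonal phiP Asym (Aw j) (Aw k) lam_neq) !mulr0.
Qed.

(** [x] and [expR x - 1] have the same sign. *)
Lemma calQ_ge0 (R : realType) (x : R) : 0 <= calQ x.
Proof.
rewrite /calQ; case: eqVneq => [//|x0]; case: (ltrP 0 x) => [x_gt0|x_le0].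
  by rewrite divr_ge0 ?ltW// subr_gt0 expR_gt1.
by rewrite -mulrNN -invrN divr_ge0 ?oppr_ge0// subr_le0 expR_le1.
Qed.

(** With [e = y - x], [phi (A y) e] exceeds the left-hand side by [phi (A e) e / 2], and the [calQ]
    term paired with [e] is nonnegative. This serves both equations of the scheme. *)
Lemma exp_integrator_dissipation (R : realType) (V : vectType R)
    (phi : V -> V -> R) (A : V -> V) (tau : R) (x y : V) :
  psd_form phi -> (forall v w, phi (A v) w = phi v (A w)) ->
  linear A -> (forall v, 0 <= phi (A v) v) -> eigen_spanned A -> 0 < tau ->
  2^-1 * phi (A y) y - 2^-1 * phi (A x) x
    <= phi (funcalc (@calQ R) (fun v => tau *: A v) (tau^-1 *: (y - x)) + A y)
           (y - x).
Proof.
move=> phiP Asym Alin A_ge0 Aspan tau_gt0.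
have AB : A (y - x) = A y - A x.
  by rewrite addrC -scaleN1r Alin scaleN1r addrC.
have Q0 : 0 <= phi (funcalc (@calQ R) (fun v => tau *: A v) (tau^-1 *: (y - x)))
           (y - x).
  rewrite linearZ (psd_formZl phiP); apply: mulr_ge0; first by rewrite invr_ge0 ltW.
  apply: funcalc_form_ge0 => //; last exact: calQ_ge0.
    by move=> v w; rewrite (psd_formZl phiP) (psd_formZr phiP) Asym.
  move=> v; have [n [lam [w [-> Aw]]]] := Aspan v.
  exists n, (fun k => tau * lam k), w; split=> // k.
  by rewrite Aw scalerA.
have := A_ge0 (y - x); rewrite AB (psd_formBl phiP) !(psd_formBr phiP).
(* The two cross terms are identified, which leaves a linear problem. *)
rewrite (psd_formC phiP (A x) y) -(Asym y x).
by move: Q0; rewrite !(psd_formBr phiP) !(psd_formDl phiP); lra.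
Qed.

(** * Periodic grids: summation by parts and eigenfunctions of the Laplacian *)

Section Grid.
Context {R : realType} {d J : nat}.
Implicit Types (k : 'I_d) (p q : gidx d J).

Lemma shiftpK k : cancel (@shiftp d J k) (shiftm k).
Proof.
by move=> p; apply/ffunP => i; rewrite !ffunE; case: eqP => // _; rewrite ordSK.
Qed.

(** Shifts permute the periodic grid, so summation by parts has no boundary terms. *)
Lemma sum_shiftp k (F : gidx d J -> R) : \sum_p F (shiftp k p) = \sum_p F p.
Proof.
by rewrite [RHS](reindex_inj (can_inj (shiftpK k))).
Qed.

Definition gmap (V W : Type) (l : V -> W) (U : grid d J V) : grid d J W :=
  [ffun p => l (U p)].

Variable h : R.

(** Difference quotients use only the linear structure of the values. With [l] a matrix entry this
    reduces tensors to scalars; with [l] of the form [a *: x] in [a] it lifts scalar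
    eigenfunctions. *)
Lemma lap_gmap (V W : lmodType R) (l : {linear V -> W}) (U : grid d J V) :
  lap h (gmap l U) = gmap l (lap h U).
Proof.
apply/ffunP => p; rewrite /lap ffunE !sum_ffunE linear_sum.
have lB x y : l (x - y) = l x - l y by exact: linearB.
have lZ a x : l (a *: x) = a *: l x by exact: linearZ.
by apply: eq_bigr => k _; rewrite !ffunE !(lZ, lB).
Qed.

Lemma linear_Dp (V : lmodType R) k : linear (@Dp R d J h V k).
Proof.
move=> a U W; apply/ffunP => p; rewrite !ffunE /= opprD addrACA -scalerBr.
by rewrite scalerDr !scalerA mulrC.
Qed.

Lemma linear_Dm (V : lmodType R) k : linear (@Dm R d J h V k).
Proof.
move=> a U W; apply/ffunP => p; rewrite !ffunE /= opprD addrACA -scalerBr.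
by rewrite scalerDr !scalerA mulrC.
Qed.

Lemma linear_lap (V : lmodType R) : linear (@lap R d J h V).
Proof.
move=> a U W; rewrite /lap scaler_sumr -big_split; apply: eq_bigr => k _ /=.
by rewrite linear_Dm linear_Dp.
Qed.

HB.instance Definition _ (V : lmodType R) := GRing.isLinear.Build R
  (grid d J V) (grid d J V) *:%R (@lap R d J h V) (@linear_lap V).

Lemma ip_psd : 0 <= h -> psd_form (@ip R d J h).
Proof.
move=> h0; split=> [W a U V /=|U V|U].
- rewrite /ip -[X in _ = X + _]/(a * _) mulrCA -mulrDr; congr (_ * _).
  rewrite mulr_sumr -big_split; apply: eq_bigr => p _ /=.
  by rewrite !ffunE mulrDl -mulrA.
- by congr (_ * _); apply: eq_bigr => p _; rewrite mulrC.
- by rewrite mulr_ge0 ?exprn_ge0// sumr_ge0// => p _; rewrite -expr2 sqr_ge0.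
Qed.

Lemma ip_Dp k (U V : grid d J R^o) : ip h (Dp h k U) V = - ip h U (Dm h k V).
Proof.
rewrite /ip -mulrN -sumrN; congr (_ * _).
transitivity (\sum_p (h^-1 * (U (shiftp k p) * V p) - h^-1 * (U p * V p))).
  by apply: eq_bigr => p _; rewrite ffunE -mulrBr -mulrBl mulrA.
(* Shifting the sum of [U p * V p] and the right-hand side puts [U] at the shifted point
   everywhere. *)
rewrite sumrB -[X in _ - X](sum_shiftp k) -sumrB -[RHS](sum_shiftp k).
by apply: eq_bigr => p _; rewrite ffunE shiftpK /= -[_ *: _]/(_ * _); ring.
Qed.

Hypothesis h_gt0 : 0 < h.
Let ipP := ip_psd (ltW h_gt0).

Lemma ip_lap (U V : grid d J R^o) :
  ip h (lap h U) V = - \sum_k ip h (Dm h k U) (Dm h k V).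
Proof.
by rewrite (psd_form_suml ipP) -sumrN; apply: eq_bigr => k _; rewrite ip_Dp.
Qed.

Lemma ip_lapC (U V : grid d J R^o) : ip h (lap h U) V = ip h U (lap h V).
Proof.
rewrite [RHS](psd_formC ipP) !ip_lap; congr (- _).
by apply: eq_bigr => k _; rewrite (psd_formC ipP).
Qed.

(** [grad2] uses forward differences and [ip_lap] backward ones; they differ by a shift. *)
Lemma grad2_lap (U : grid d J R^o) : grad2 h U = - ip h (lap h U) U.
Proof.
rewrite ip_lap opprK; apply: eq_bigr => k _; rewrite /ip; congr (_ * _).
rewrite -[RHS](sum_shiftp k); apply: eq_bigr => p _.
by rewrite !ffunE shiftpK.
Qed.

(** The matrix of the Laplacian on point masses is diagonalized by some [P]. The [e i] are the rows
    of [P] and the [f i] the columns of its inverse, so the last identity is [invmx P *m P = 1]. *)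
Lemma lap_eigenbasis :
  exists (e f : 'I_#|{: gidx d J}| -> grid d J R^o)
    (lam : 'I_#|{: gidx d J}| -> R),
    (forall i, lap h (e i) = lam i *: e i) /\
    forall p q, \sum_i e i p * f i q = (p == q)%:R.
Proof.
pose N := #|{: gidx d J}|.
pose grd (x : 'rV[R]_N) : grid d J R^o := [ffun p => x 0 (enum_rank p)].
pose dl (i : 'I_N) := grd (delta_mx 0 i).
pose A : 'M[R]_N := \matrix_(i, j) lap h (dl i) (enum_val j).
have lap_grd x : lap h (grd x) = grd (x *m A).
  have grdE : grd x = \sum_i x 0 i *: dl i.
    apply/ffunP => p; rewrite sum_ffunE ffunE (bigD1 (enum_rank p))//= big1.
      by rewrite !ffunE mxE !eqxx -[_ *: _]/(_ * _) mulr1 addr0.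
    move=> i /negPf ip; rewrite !ffunE mxE eqxx [_ == i]eq_sym ip.
    exact: mulr0.
  rewrite grdE linear_sum /=; apply/ffunP => p; rewrite sum_ffunE.
  rewrite ffunE mxE; apply: eq_bigr => i _.
  by rewrite linearZ_LR !ffunE mxE enum_rankK.
(* Up to the nonzero factor [h ^+ d], the entries of [A] are [ip h (lap h (dl i)) (dl j)]. *)
have symA : A^T = A.
  have ip_dl (U : grid d J R^o) j : ip h U (dl j) = h ^+ d * U (enum_val j).
    rewrite /ip (bigD1 (enum_val j))//= big1 => [|p pj].
      by rewrite !ffunE mxE eqxx enum_valK eqxx mulr1 addr0.
    rewrite !ffunE mxE eqxx -(inj_eq enum_val_inj) enum_rankK.
    by rewrite (negPf pj) mulr0.
  apply/matrixP => i j; apply: (mulfI (lt0r_neq0 (exprn_gt0 d h_gt0))).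
  by rewrite !mxE -!ip_dl ip_lapC (psd_formC ipP).
have [P [D [Punit PA]]] := realsym_diagonalizable symA.
exists (fun i => grd (row i P)), (fun i => [ffun q => invmx P (enum_rank q) i]),
  (fun i => D 0 i); split=> [i|p q].
  rewrite lap_grd -row_mul PA; apply/ffunP => p; rewrite !ffunE.
  by rewrite mul_diag_mx !mxE.
transitivity ((invmx P *m P) (enum_rank q) (enum_rank p)).
  by rewrite mxE; apply: eq_bigr => i _; rewrite !ffunE !mxE mulrC.
by rewrite mulVmx// mxE (inj_eq enum_rank_inj) eq_sym.
Qed.

(** [U] is the sum of the scalar eigenfunctions [e i] times constant vectors [v i], which the dual
    family [f i] reads off from [U]. *)
Lemma lap_eigen_spanned (V : lmodType R) : eigen_spanned (@lap R d J h V).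
Proof.
move=> U; have [e [f [lam [eE ef]]]] := lap_eigenbasis.
pose v i : V := \sum_q (f i q : R) *: U q.
pose l (x : V) : R^o -> V := fun a => a *: x.
have l_linear x : linear (l x) by move=> a b c; rewrite /l scalerDl scalerA.
pose lL x := HB.pack_for {linear R^o -> V} (l x)
  (GRing.isLinear.Build _ _ _ _ _ (l_linear x)).
exists #|{: gidx d J}|, lam, (fun i => gmap (lL (v i)) (e i)); split=> [|i].
  apply/ffunP => p; rewrite sum_ffunE.
  transitivity (\sum_q \sum_i (e i p * f i q : R) *: U q).
    under eq_bigr do rewrite -scaler_suml ef.
    rewrite (bigD1 p)//= eqxx scale1r big1 ?addr0// => q /negPf qp.
    by rewrite eq_sym qp scale0r.
  rewrite exchange_big; apply: eq_bigr => i _; rewrite ffunE /= /l scaler_sumr.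
  by apply: eq_bigr => q _; rewrite scalerA.
by rewrite lap_gmap eE; apply/ffunP => p; rewrite !ffunE /= /l scalerA.
Qed.
End Grid.

(** * The operators of the scheme and its energy *)

Section Tensor.
Context {R : realType} {d J : nat}.
Variables (m : model R) (kappa h : R).
Hypothesis h_gt0 : 0 < h.
Implicit Types (P Q : grid d J (symtl R d)) (u v : grid d J R^o).

Definition ipQ P Q : R := ipm h (mxgrid P) (mxgrid Q).

Definition coef (i j : 'I_d) (A : symtl R d) : R^o := vsval A i j.

Lemma coef_linear i j : linear (coef i j).
Proof. by move=> a A B; rewrite /coef linearP !mxE. Qed.

HB.instance Definition _ i j :=
  GRing.isLinear.Build R (symtl R d) R^o *:%R (coef i j) (coef_linear i j).

Lemma entry_mxgrid Q i j : entry (mxgrid Q) i j = gmap (coef i j) Q.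
Proof. by apply/ffunP => p; rewrite !ffunE. Qed.

Lemma ipQE P Q :
  ipQ P Q = \sum_i \sum_j ip h (gmap (coef i j) P) (gmap (coef i j) Q).
Proof. by do 2!(apply: eq_bigr => ? _); rewrite !entry_mxgrid. Qed.

Let ipP := @ip_psd R d J h (ltW h_gt0).

Lemma ipQ_psd : psd_form ipQ.
Proof.
split=> [W a P Q|P Q|Q]; rewrite !ipQE.
- rewrite scaler_sumr -big_split; apply: eq_bigr => i _ /=.
  rewrite scaler_sumr -big_split; apply: eq_bigr => j _ /=.
  rewrite -[X in _ = X + _]/(a * _) -(psd_formZl ipP) -(psd_formDl ipP).
  by congr ip; apply/ffunP => p; rewrite !ffunE linearP.
- by do 2!(apply: eq_bigr => ? _); rewrite (psd_formC ipP).
- by do 2!(apply: sumr_ge0 => ? _); exact: (psd_form_ge0 ipP).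
Qed.

Lemma ipQ_lapC P Q : ipQ (lap h P) Q = ipQ P (lap h Q).
Proof.
by rewrite !ipQE; do 2!(apply: eq_bigr => ? _); rewrite -!lap_gmap ip_lapC.
Qed.

Lemma grad2m_lap Q : grad2m h (mxgrid Q) = - ipQ (lap h Q) Q.
Proof.
rewrite ipQE /grad2m -sumrN; apply: eq_bigr => i _; rewrite -sumrN.
by apply: eq_bigr => j _; rewrite entry_mxgrid (grad2_lap h_gt0) -lap_gmap.
Qed.

Lemma opL_linear : linear (@opL R d J m kappa h).
Proof.
move=> a P Q; rewrite /opL linearP /=.
by rewrite !(scalerDr, scalerN, scalerA) opprD addrACA ![a * _]mulrC.
Qed.

Lemma opD_linear : linear (@opD R d J m kappa h).
Proof.
move=> a u v; rewrite /opD !linearP /=.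
by rewrite !(scalerDr, scalerA) addrACA ![a * _]mulrC.
Qed.

Lemma opLC P Q : ipQ (opL m kappa h P) Q = ipQ P (opL m kappa h Q).
Proof.
rewrite /opL (psd_formDl ipQ_psd) (psd_formDr ipQ_psd) (psd_formNl ipQ_psd).
rewrite (psd_formNr ipQ_psd) !(psd_formZr ipQ_psd) !(psd_formZl ipQ_psd).
by rewrite ipQ_lapC.
Qed.

Lemma opDC u v : ip h (opD m kappa h u) v = ip h u (opD m kappa h v).
Proof.
rewrite /opD (psd_formDl ipP) (psd_formDr ipP).
by rewrite !(psd_formZr ipP) !(psd_formZl ipP) !ip_lapC.
Qed.

(** [opL] is a polynomial in [lap], hence keeps its eigenvectors; likewise [opD] below. *)
Lemma opL_eigen_spanned : eigen_spanned (@opL R d J m kappa h).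
Proof.
move=> Q; have [n [lam [w [-> wE]]]] := lap_eigen_spanned h_gt0 Q.
exists n, (fun k => - (pK m * lam k) + kappa), w; split=> // k.
by rewrite /opL wE scalerA scalerDl scaleNr.
Qed.

Lemma opD_eigen_spanned : eigen_spanned (@opD R d J m kappa h).
Proof.
move=> u; have [n [lam [w [-> wE]]]] := lap_eigen_spanned h_gt0 u.
exists n, (fun k => 2 * pB0 m * (lam k * lam k) + kappa), w; split=> // k.
have wwE : lap h (lap h (w k)) = (lam k * lam k) *: w k.
  by rewrite wE linearZ_LR [LHS]/= wE scalerA.
by rewrite /opD wwE scalerA scalerDl.
Qed.

Lemma opL_form Q :
  ipQ (opL m kappa h Q) Q = pK m * grad2m h (mxgrid Q) + kappa * ipQ Q Q.
Proof.
rewrite /opL (psd_formDl ipQ_psd) (psd_formNl ipQ_psd) !(psd_formZl ipQ_psd).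
by rewrite grad2m_lap mulrN.
Qed.

Lemma opD_form u :
  ip h (opD m kappa h u) u
    = 2 * pB0 m * ip h (lap h u) (lap h u) + kappa * ip h u u.
Proof.
by rewrite /opD (psd_formDl ipP) !(psd_formZl ipP) ip_lapC.
Qed.

Lemma grad2m_ge0 Q : 0 <= grad2m h (mxgrid Q).
Proof.
by do 3!(apply: sumr_ge0 => ? _); exact: (psd_form_ge0 ipP).
Qed.

(** This puts the energy in the form handled by [exp_integrator_dissipation]. *)
Lemma energyE Q u s : energy m kappa h Q u s =
  2^-1 * ipQ (opL m kappa h Q) Q + 2^-1 * ip h (opD m kappa h u) u + s.
Proof. rewrite opL_form opD_form /energy -/(ipQ Q Q); lra. Qed.

Lemma gsav_ei_step_energy (zeta : R -> R) (tau : R) Q u s Q' u' s' :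
  admissible m -> 0 <= kappa -> 0 < tau ->
  gsav_ei_step m kappa h zeta tau Q u s Q' u' s' ->
  energy m kappa h Q' u' s' <= energy m kappa h Q u s.
Proof.
move=> [K_gt0 _ _ _ _ _ _ B0_gt0 _] kappa_ge0 tau_gt0 [NE calNE ->].
(* By the scheme, the update of [s] subtracts exactly the pairings that [exp_integrator_dissipation]
   bounds from below. *)
rewrite !energyE -NE -calNE -/(ipQ _ (Q' - Q)).
have K_ge0 := ltW K_gt0; have B0_ge0 := ltW B0_gt0.
have L_ge0 P : 0 <= ipQ (opL m kappa h P) P.
  have ipQ_ge0 := psd_form_ge0 ipQ_psd.
  by rewrite opL_form !(ipQ_ge0, grad2m_ge0, addr_ge0, mulr_ge0).
have D_ge0 v : 0 <= ip h (opD m kappa h v) v.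
  have ip_ge0 := psd_form_ge0 ipP.
  by rewrite opD_form !(ip_ge0, addr_ge0, mulr_ge0).
have := exp_integrator_dissipation Q Q' ipQ_psd opLC opL_linear L_ge0
  opL_eigen_spanned tau_gt0.
have := exp_integrator_dissipation u u' ipP opDC opD_linear D_ge0
  opD_eigen_spanned tau_gt0.
lra.
Qed.
End Tensor.

Theorem theorem2p3 (R : realType) (d : nat) (hd : d = 2%N \/ d = 3%N)
  (m : model R) (hm : admissible m)
  (zeta : R -> R)
  (zeta_gt0 : forall x : R, 0 < zeta x)
  (zeta_derivable : forall x : R, derivable zeta x 1)
  (zeta_C1 : continuous (zeta^`())%classic)
  (zeta_mono : forall x : R, 0 <= (zeta^`())%classic x)
  (L : R) (hL : 0 < L) (J : nat) (hJ : (0 < J)%N)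
  (h : R) (hh : h = L / J%:R)
  (Qini : 'rV[R]_d -> symtl R d) (Qini_per : box_periodic L Qini)
  (uini : 'rV[R]_d -> R) (uini_per : box_periodic L uini)
  (kappa : R) (hkappa : 0 < kappa) (tau : R) (htau : 0 < tau)
  (Q : nat -> grid d J (symtl R d)) (u : nat -> grid d J R^o) (s : nat -> R)
  (hinit : gsav_ei_init m kappa h Qini uini (Q 0%N) (u 0%N) (s 0%N))
  (hstep : forall n : nat, gsav_ei_step m kappa h zeta tau
             (Q n) (u n) (s n) (Q n.+1) (u n.+1) (s n.+1))
  (n : nat) :
  energy m kappa h (Q n.+1) (u n.+1) (s n.+1)
    <= energy m kappa h (Q n) (u n) (s n).
Proof.
apply: gsav_ei_step_energy (hstep n) => //; last exact: ltW.
by rewrite hh divr_gt0// ltr0n.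
Qed.
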